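(* Let $\bm{\delta}\in\{1,\dots,l\}^{N+1}$ be any switching sequence and let $\tilde{\mathcal{X}}\subseteq\mathcal{X}_0$ be a set of states such that $J(x,\bm{\delta})<\infty$ for all $x\in\tilde{\mathcal{X}}$. Then $J(x,\bm{\delta})<\infty$ for all $x\in\mathrm{Conv}(\tilde{\mathcal{X}})$.
   Context: Conventions. A polytope is the intersection of finitely many (open or closed) halfspaces. Sets form a convex partition of $S$ if they are nonempty, pairwise disjoint polytopes with union $S$. $\bar S$ is the closure and $\mathrm{Conv}(S)$ the convex hull of $S$. System. $\mathcal{X}\subseteq\mathbb{R}^n$ and $\mathcal{U}\subseteq\mathbb{R}^m$ are compact polytopes with the origin in their interior. $\{P_i\}_{i\in\mathcal{L}}$, $\mathcal{L}=\{1,\dots,l\}$, is a convex partition of $\mathcal{X}$. The piecewise affine dynamics are $x(k+1)=A_ix(k)+Bu(k)+c_i$ for $x(k)\in P_i$, with $A_i\in\mathbb{R}^{n\times n}$, $B\in\mathbb{R}^{n\times m}$, $c_i\in\mathbb{R}^n$; they are continuous: $A_ix+Bu+c_i=A_jx+Bu+c_j$ for all $x\in\bar P_i\cap\bar P_j$ and all $u$. The terminal set $\mathcal{X}_{\mathrm f}\subseteq\mathcal{X}$ is a polytope containing the origin in its interior, positive invariant under linear control laws: for every $i$ with $P_i\cap\mathcal{X}_{\mathrm f}\ne\emptyset$ there is $K_i\in\mathbb{R}^{m\times n}$ such that for all $x\in P_i\cap\mathcal{X}_{\mathrm f}$, $K_ix\in\mathcal{U}$ and $A_ix+BK_ix+c_i\in\mathcal{X}_{\mathrm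 f}$. In the optimization problems below $\mathcal{X}_{\mathrm f}$ is closed. Optimal control problem. Fix a horizon $N\ge1$. For $x\in\mathbb{R}^n$ and a switching sequence $\bm{\delta}=(\delta(0),\dots,\delta(N))\in\{1,\dots,l\}^{N+1}$, let $$J(x,\bm{\delta})=\min_{\mathbf{x},\mathbf{u}}J(\mathbf{x},\mathbf{u})$$ over $\mathbf{x}=(x(0),\dots,x(N))$, $\mathbf{u}=(u(0),\dots,u(N-1))$ subject to: $x(0)=x$; $x(k+1)=A_{\delta(k)}x(k)+Bu(k)+c_{\delta(k)}$ for $k=0,\dots,N-1$; $x(k)\in\bar P_{\delta(k)}$ for $k=0,\dots,N$; $(x(k),u(k))\in\mathcal{X}\times\mathcal{U}$ for $k=0,\dots,N-1$; $x(N)\in\mathcal{X}_{\mathrm f}$. Set $J(x,\bm{\delta})=\infty$ if infeasible. Let $J(x)=\min_{\bm{\delta}}J(x,\bm{\delta})$ and $\mathcal{X}_0=\{x \mid J(x)<\infty\}$. Cost. $J(\mathbf{x},\mathbf{u})=\sum_{k=0}^{N-1}\big(\|Qx(k)\|_{p_1}+\|Ru(k)\|_{p_2}\big)+\|Px(N)\|_{p_3}$ with $p_1,p_2,p_3\in\{1,\infty\}$ and $Q,R,P$ real matrices with $n,m,n$ columns and rank $n,m,n$, respectively (the weight $P$ is unrelated to the regions $P_i$). *)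

(* Defs.v *)
From HB Require Import structures.
From mathcomp Require Import all_boot all_order all_algebra.
From mathcomp Require Import all_classical all_reals all_analysis.
Import Order.TTheory GRing.Theory Num.Theory.
Import numFieldNormedType.Exports.

Set Implicit Arguments.
Unset Strict Implicit.
Unset Printing Implicit Defensive.

Local Open Scope classical_set_scope.
Local Open Scope ring_scope.

Section Polytopes.
Context {R : realType} {n : nat}.
Implicit Types S H : set 'cV[R]_n.

Definition open_halfspace H :=
  exists (a : 'rV[R]_n) (b : R), a != 0 /\ H = [set x | (a *m x) 0 0 < b].

Definition closed_halfspace H :=
  exists (a : 'rV[R]_n) (b : R), a != 0 /\ H = [set x | (a *m x) 0 0 <= b].

(* A polytope need be neither closed, nor bounded, nor nonempty. *)
Definition polytope S :=
  exists (k : nat) (H : 'I_k -> set 'cV[R]_n),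
    (forall i, open_halfspace (H i) \/ closed_halfspace (H i)) /\
    S = \bigcap_i H i.

Definition convex_partition {l : nat} (P : 'I_l -> set 'cV[R]_n) S :=
  classical_sets.partition setT P S /\ forall i, polytope (P i).

Definition convex_hull S : set 'cV[R]_n := 
  smallest (@convex_set R 'cV[R]_n) S.

End Polytopes.

Variant norm_index := p_one | p_infty.

(* The library norm on matrices is the maximum of the absolute values of the
   entries, i.e. the infinity norm on column vectors. *)
Definition pnorm {R : realType} {q : nat} (p : norm_index) (v : 'cV[R]_q) : R :=
  match p with
  | p_one => \sum_i `|v i 0|
  | p_infty => `|v|
  end.

(* n, m: state and input dimensions; l: number of modes, indexed from 0;
   qQ, qR, qP: numbers of rows of the weights. *)
Record pwa_ocp (R : realType) (n m l qQ qR qP : nat) := PwaOcp {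
  Xset : set 'cV[R]_n;
  Uset : set 'cV[R]_m;
  Xterm : set 'cV[R]_n;
  region : 'I_l -> set 'cV[R]_n;
  dynA : 'I_l -> 'M[R]_n;
  dynB : 'M[R]_(n, m);
  dync : 'I_l -> 'cV[R]_n;
  wtQ : 'M[R]_(qQ, n);
  wtR : 'M[R]_(qR, m);
  wtP : 'M[R]_(qP, n);
  p1 : norm_index;
  p2 : norm_index;
  p3 : norm_index }.

Section OptimalControl.
Context {R : realType} {n m l qQ qR qP : nat}.
Variable D : pwa_ocp R n m l qQ qR qP.

Definition pwa_step (i : 'I_l) (x : 'cV[R]_n) (u : 'cV[R]_m) : 'cV[R]_n :=
  dynA D i *m x + dynB D *m u + dync D i.

Definition continuous_dynamics : Prop :=
  forall i j x u, (closure (region D i) `&` closure (region D j)) x ->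
    pwa_step i x u = pwa_step j x u.

Definition terminal_invariance : Prop :=
  forall i, region D i `&` Xterm D !=set0 ->
    exists K : 'M[R]_(m, n), forall x, (region D i `&` Xterm D) x ->
      Uset D (K *m x) /\ Xterm D (pwa_step i x (K *m x)).

Record standing_assumptions : Prop := StandingAssumptions {
  X_polytope : polytope (Xset D);
  X_compact : compact (Xset D);
  X_interior0 : (Xset D)° 0;
  U_polytope : polytope (Uset D);
  U_compact : compact (Uset D);
  U_interior0 : (Uset D)° 0;
  region_partition : convex_partition (region D) (Xset D);
  dynamics_continuous : continuous_dynamics;
  Xterm_sub : Xterm D `<=` Xset D;
  Xterm_polytope : polytope (Xterm D);
  Xterm_interior0 : (Xterm D)° 0;
  Xterm_invariant : terminal_invariance;
  Xterm_closed : closed (Xterm D);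
  wtQ_rank : \rank (wtQ D) = n;
  wtR_rank : \rank (wtR D) = m;
  wtP_rank : \rank (wtP D) = n }.

Variable N : nat.

(* The times k and k+1, for k < N, as indices into a state trajectory. *)
Definition tnow (k : 'I_N) : 'I_N.+1 := widen_ord (leqnSn N) k.
Definition tnext (k : 'I_N) : 'I_N.+1 := lift ord0 k.

Definition trajectory : Type := ('I_N.+1 -> 'cV[R]_n) * ('I_N -> 'cV[R]_m).

Definition cost (z : trajectory) : R :=
  \sum_(k < N) (pnorm (p1 D) (wtQ D *m z.1 (tnow k)) +
                pnorm (p2 D) (wtR D *m z.2 k)) +
  pnorm (p3 D) (wtP D *m z.1 ord_max).

Definition switching_sequence : Type := {ffun 'I_N.+1 -> 'I_l}.

Definition feasible (x : 'cV[R]_n) (delta : switching_sequence)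
    (z : trajectory) : Prop :=
  [/\ z.1 ord0 = x,
      forall k, z.1 (tnext k) = pwa_step (delta (tnow k)) (z.1 (tnow k)) (z.2 k),
      forall k, closure (region D (delta k)) (z.1 k),
      forall k, Xset D (z.1 (tnow k)) /\ Uset D (z.2 k) &
      Xterm D (z.1 ord_max)].

(* The infimum of the empty set is +oo.  Under the standing assumptions the
   feasible set is compact, so the infimum of a feasible problem is attained. *)
Definition Jseq (x : 'cV[R]_n) (delta : switching_sequence) : \bar R :=
  ereal_inf [set (cost z)%:E | z in feasible x delta].

Definition Jopt (x : 'cV[R]_n) : \bar R :=
  \big[Order.min/+oo%E]_(delta : switching_sequence) Jseq x delta.

Definition X0 : set 'cV[R]_n := [set x | (Jopt x < +oo)%E].

End OptimalControl.

(* Main.v *)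
(** For a fixed switching sequence the constraints are affine in the trajectory
    apart from membership in convex sets (a region enters only through its
    closure, which is convex because the region is a polytope).  Hence a convex
    combination of feasible trajectories is feasible for the corresponding
    convex combination of initial states, and the set of states with a feasible
    trajectory is convex; finally, [J(x, delta)] is finite exactly when a
    feasible trajectory exists, the cost being real-valued. *)

Require Import Defs.
From HB Require Import structures.
From mathcomp Require Import all_boot all_order all_algebra.
From mathcomp Require Import unstable.
From mathcomp Require Import all_classical all_reals all_analysis.
Import Order.TTheory GRing.Theory Num.Theory.
Import numFieldNormedType.Exports.

Set Implicit Arguments.
Unset Strict Implicit.
Unset Printing Implicit Defensive.

Local Open Scope classical_set_scope.
Local Open Scope ring_scope.
Local Open Scope convex_scope.

Section ConvexSets.
Context {R : numDomainType} {M : lmodType R}.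
Implicit Types A : set (convex_lmodType M).

(** Replaces the boolean membership in [convex_set] by plain application, the form in which all
    later hypotheses come. *)
Lemma convex_setP A :
  convex_set A <-> forall x y (t : {i01 R}), A x -> A y -> A (x <| t |> y).
Proof.
split=> [cA x y t Ax Ay|cA x y t].
  by apply/set_mem/cA; exact/mem_set.
by rewrite !inE; exact: cA.
Qed.

Lemma convex_set_bigcap {I : Type} (D : set I) (F : I -> set (convex_lmodType M)) :
  (forall i, D i -> convex_set (F i)) -> convex_set (\bigcap_(i in D) F i).
Proof.
move=> cF; apply/convex_setP => x y t Fx Fy i Di.
exact: (convex_setP (F i)).1 (cF i Di) x y t (Fx i Di) (Fy i Di).
Qed.

End ConvexSets.

(** For fixed [t] the combination is jointly continuous in its two points, so any neighbourhood of
    it contains the combinations of all points near [x] with all points near [y]; both kinds of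
    points can be picked in [A]. *)
Lemma convex_set_closure {R : realType} {V : normedModType R}
    (A : set (convex_lmodType V)) :
  convex_set A -> convex_set (closure (A : set V) : set (convex_lmodType V)).
Proof.
move=> /convex_setP cA; apply/convex_setP => x y t clAx clAy B nB.
have : (fun p : V * V => t%:num *: p.1 + t%:num.~ *: p.2) @ (x, y) -->
       t%:num *: (x : V) + t%:num.~ *: (y : V).
  by apply: cvgD; apply: cvgZr; [exact: cvg_fst|exact: cvg_snd].
move=> /(_ _ nB)[[P Q] /= [nP nQ] PQB].
have [x' [Ax' Px']] := clAx _ nP; have [y' [Ay' Qy']] := clAy _ nQ.
exists ((x' : convex_lmodType V) <| t |> y'); split; first exact: cA.
exact: (PQB (x', y')).
Qed.

Section ConvexPolytopes.
Context {R : realType} {n : nat}.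
Implicit Types (S : set 'cV[R]_n) (x y : convex_lmodType 'cV[R]_n).
Implicit Type t : {i01 R}.

Lemma row_conv (a : 'rV[R]_n) x y t :
  (a *m (x <| t |> y)) 0 0 =
  ((a *m x) 0 0 : R^o) <| t |> ((a *m y) 0 0 : R^o).
Proof. by rewrite mulmxDr -!scalemxAr !mxE. Qed.

Lemma convex_set_open_halfspace S : open_halfspace S -> convex_set S.
Proof.
move=> [a [b [_ ->]]]; apply/convex_setP => x y t /= xb yb.
rewrite row_conv -subr_gt0.
(* One of the weights may vanish, so strict bounds cannot be added termwise. Instead the slack is
   written as a combination of two positive slacks. *)
rewrite (_ : b - _ = (b - (a *m x) 0 0 : R^o) <| t |> (b - (a *m y) 0 0 : R^o)).
  by apply: convR_gt0; rewrite subr_gt0.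
by rewrite !convRE !mulrBr addrACA -mulrDl add_onemK mul1r opprD.
Qed.

Lemma convex_set_closed_halfspace S : closed_halfspace S -> convex_set S.
Proof.
move=> [a [b [_ ->]]]; apply/convex_setP => x y t /= xb yb.
rewrite row_conv convRE -[leRHS](convmm t (b : R^o)).
by rewrite lerD// ler_wpM2l// onem_ge0.
Qed.

Lemma convex_set_polytope S : polytope S -> convex_set S.
Proof.
move=> [k [H [hH ->]]]; apply: convex_set_bigcap => i _.
by case: (hH i) => [/convex_set_open_halfspace|/convex_set_closed_halfspace].
Qed.

End ConvexPolytopes.

Section Feasibility.
Context {R : realType} {n m l qQ qR qP N : nat} (D : pwa_ocp R n m l qQ qR qP).
Local Notation vec q := (convex_lmodType 'cV[R]_q).
Implicit Types (x y : vec n) (u v : vec m) (t : {i01 R}).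
Implicit Types (delta : switching_sequence (l := l) N).

Lemma Jseq_lt_pinfty x delta :
  (Jseq D x delta < +oo)%E <-> exists z, feasible D x delta z.
Proof.
split=> [/ereal_inf_lt[_ [z fz _] _]|[z fz]]; first by exists z.
by apply/ereal_inf_ltP; exists (cost D z)%:E; [exists z|exact: ltry].
Qed.

(** The weights sum to one, so the offset [dync D i] is its own combination. Both steps use the same
    mode [i], hence the need for a common switching sequence. *)
Lemma pwa_step_conv (i : 'I_l) x y u v t :
  pwa_step D i (x <| t |> y) (u <| t |> v) =
  (pwa_step D i x u : vec n) <| t |> (pwa_step D i y v : vec n).
Proof.
rewrite /pwa_step -[in LHS](convmm t (dync D i : vec n)).
rewrite /conv/= !mulmxDr -!scalemxAr !scalerDr.
by rewrite [X in X + _ = _]addrACA; exact: addrACA.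
Qed.

Definition traj_conv t (z w : trajectory (R := R) (n := n) (m := m) N) :
    trajectory N :=
  (fun k => (z.1 k : vec n) <| t |> (w.1 k : vec n),
   fun k => (z.2 k : vec m) <| t |> (w.2 k : vec m)).

Lemma feasible_conv x y delta z w t : standing_assumptions D ->
  feasible D x delta z -> feasible D y delta w ->
  feasible D (x <| t |> y) delta (traj_conv t z w).
Proof.
move=> std [z0 zS zP zXU zN] [w0 wS wP wXU wN].
(* The dimension stays general, to serve states ([n]) and inputs ([m]) alike. *)
have convP q (S : set 'cV[R]_q) : polytope S ->
    forall a b : vec q, S a -> S b -> S (a <| t |> b).
  by move=> /convex_set_polytope/convex_setP cS a b; exact: cS.
split=> [|k|k|k|] /=.
- by rewrite z0 w0.
- by rewrite zS wS pwa_step_conv.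
- have /convex_set_polytope/convex_set_closure/convex_setP :=
    (region_partition std).2 (delta k).
  exact.
- have [[zX zU] [wX wU]] := (zXU k, wXU k); split.
    exact: convP (X_polytope std) _ _ zX wX.
  exact: convP (U_polytope std) _ _ zU wU.
- exact: convP (Xterm_polytope std) _ _ zN wN.
Qed.

Lemma convex_set_feasible delta : standing_assumptions D ->
  convex_set [set x : vec n | exists z, feasible D x delta z].
Proof.
move=> std; apply/convex_setP => x y t [z fz] [w fw].
by exists (traj_conv t z w); exact: feasible_conv.
Qed.

End Feasibility.

Theorem proposition2 (R : realType) (n m l qQ qR qP N : nat)
    (D : pwa_ocp R n m l qQ qR qP)
    (N_ge1 : (1 <= N)%N)
    (D_std : standing_assumptions D)
    (delta : switching_sequence (l := l) N)
    (Xt : set 'cV[R]_n)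
    (Xt_sub : Xt `<=` X0 D N)
    (Xt_delta : forall x, Xt x -> (Jseq D x delta < +oo)%E) :
  forall x, convex_hull Xt x -> (Jseq D x delta < +oo)%E.
Proof.
move=> x hx; apply/Jseq_lt_pinfty.
(* The hull is the least convex superset, so two-point combinations suffice; it remains to see that
   [Xt] lies in the feasible set. *)
apply: (smallest_sub (convex_set_feasible (delta := delta) D_std)) hx.
by move=> y /Xt_delta/Jseq_lt_pinfty.
Qed.
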